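(* Let $v,k,t,\lambda$ be integers with $t\ge 1$, let $A_1$ be the adjacency matrix of a strongly regular digraph with parameter set $(v,k,t,\lambda,t)$, and put $s=t-\lambda$. Suppose there exist $0$-$1$ matrices $B_1$ of size $v\times 4t$ and $C_1$ of size $4t\times v$ satisfying $$B_1C_1=tJ_v,\quad B_1P_1=tJ_{v,4t},\quad P_1C_1=tJ_{4t,v},\quad A_1B_1+sB_1=tJ_{v,4t},\quad C_1A_1+sC_1=tJ_{4t,v},\quad C_1B_1+sP_1=tJ_{4t},$$ $$B_1J_{4t}=2tJ_{v,4t},\quad J_vB_1=kJ_{v,4t},\quad C_1J_v=kJ_{4t,v},\quad J_{4t}C_1=2tJ_{4t,v},$$ together with the blockiness conditions: (i) if any row of $B_1$ is split into its first $2t$ and last $2t$ entries, exactly one of these two blocks consists entirely of ones and the other entirely of zeros; (ii) if any column of $C_1$ is split into its first $2t$ and last $2t$ entries, each of these two blocks contains exactly $t$ ones. Define for $n\ge 2$ $$B_n=\begin{pmatrix} K_2\otimes B_{n-1}\otimes J_{1,2}\\ I_2\otimes P_{n-1}\otimes J_{1,2}\end{pmatrix},\qquad C_n=\begin{pmatrix} J_{2^n,1}\otimes I_2\otimes \alpha_{2^{n-1}}(C_{n-1}) & J_{2^n,1}\otimes I_2\otimes \alpha_{2^{n-1}}(P_{n-1})\end{pmatrix},$$ and for $n\ge 1$ $$A_{n+1}=\begin{pmatrix} A_n & 0 & B_n & 0\\ 0 & A_n & 0 & B_n\\ 0 & C_n & 0 & P_n\\ C_n & 0 & P_n & 0\end{pmatrix}=\begin{pmatrix}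 I_2\otimes A_n & I_2\otimes B_n\\ K_2\otimes C_n & K_2\otimes P_n\end{pmatrix}.$$ Then for every $n\ge 1$, $A_n$ is the adjacency matrix of a strongly regular digraph with parameter set $\bigl((v+(2^{n+1}-4)t)2^{n-1},\ k+(2^n-2)t,\ t,\ \lambda,\ t\bigr)$.
   Context: Digraphs have no loops and no multiple edges in the same direction; the adjacency matrix $A$ has $A(i,j)=1$ if there is an edge from vertex $i$ to vertex $j$ and $0$ otherwise. A strongly regular digraph with parameter set $(v,k,t,\lambda,\mu)$ is a digraph on $v$ vertices whose adjacency matrix $A$ satisfies $A^2=tI_v+\lambda A+\mu(J_v-I_v-A)$ and $AJ_v=J_vA=kJ_v$. Notation: $I_m$ is the identity matrix of order $m$; $J_m$ is the all-ones square matrix of order $m$; $J_{m,l}$ is the all-ones $m\times l$ matrix; $K_m$ is the $m\times m$ exchange matrix with $K_m(i,j)=1$ if $i+j=m+1$ and $0$ otherwise; $\otimes$ is the Kronecker product. For $n\ge1$, $P_n=J_{2^n,1}\otimes K_{2^n}\otimes J_{t,t\cdot 2^n}$ (a square matrix of order $t\cdot 4^n$). For an $m\times l$ matrix $X$ and $s'$ dividing $m$, $\alpha_{s'}(X)$ denotes the matrix formed by the first $m/s'$ rows of $X$. Block matrices are written in the usual block form, with $0$ denoting zero blocks of appropriate size. *)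

(* Defs.v *)
From mathcomp Require Export all_boot all_order all_algebra.
From mathcomp Require Export mxtens.

Set Implicit Arguments.
Unset Strict Implicit.
Unset Printing Implicit Defensive.

Import GRing.Theory.
Local Open Scope ring_scope.

Definition ones_mx (m l : nat) : 'M[int]_(m, l) := const_mx 1.

(* With 1-based indices the condition is i + j = m + 1; ordinals start at 0. *)
Definition exchange_mx (m : nat) : 'M[int]_m :=
  \matrix_(i, j) ((i + j).+1 == m)%N%:R.

Definition adjmx (m : nat) (e : rel 'I_m) : 'M[int]_m :=
  \matrix_(i, j) (e i j)%:R.

Definition strongly_regular_digraph (m : nat) (e : rel 'I_m)
    (v : nat) (k t lambda mu : int) : Prop :=
  let A := adjmx e in
  [/\ irreflexive e, m = v,
      A *m A = t *: 1%:M + lambda *: A + mu *: (ones_mx m m - 1%:M - A),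
      A *m ones_mx m m = k *: ones_mx m m
    & ones_mx m m *m A = k *: ones_mx m m].

Definition adjmx_of_srd (m : nat) (A : 'M[int]_m)
    (v : nat) (k t lambda mu : int) : Prop :=
  exists2 e : rel 'I_m,
    A = adjmx e & strongly_regular_digraph e v k t lambda mu.

Definition zero_one_mx (m l : nat) (X : 'M[int]_(m, l)) : Prop :=
  forall i j, X i j = 0 \/ X i j = 1.

(* alpha_s(X): the first m / s rows of X, meant for s dividing m. *)
Definition alpha (s m l : nat) (X : 'M[int]_(m, l)) : 'M[int]_(m %/ s, l) :=
  rowsub (widen_ord (leq_div m s)) X.

Lemma expn_4_2 n : (4 ^ n = 2 ^ n * 2 ^ n)%N.
Proof. by rewrite -expnMn. Qed.

Lemma P_rows t n : (2 ^ n * 2 ^ n * t = 4 ^ n * t)%N.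
Proof. by rewrite expn_4_2. Qed.

Lemma P_cols t n : (1 * 2 ^ n * (t * 2 ^ n) = 4 ^ n * t)%N.
Proof. by rewrite mul1n expn_4_2 mulnCA mulnC. Qed.

(* The casts in this file only identify provably equal dimensions. *)
Definition P_mx (t n : nat) : 'M[int]_(4 ^ n * t) :=
  castmx (P_rows t n, P_cols t n)
    (ones_mx (2 ^ n) 1 *t exchange_mx (2 ^ n) *t ones_mx t (t * 2 ^ n)).

Lemma B_rows m w : (2 * m * 1 + 2 * w * 1 = 2 * m + 2 * w)%N.
Proof. by rewrite !muln1. Qed.

Lemma B_cols t n : (2 * (4 ^ n * t) * 2 = 4 ^ n.+1 * t)%N.
Proof. by rewrite expnS mulnAC mulnA. Qed.

(* B_n |-> B_(n+1), for n >= 1, where B_n has m rows. *)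
Definition B_step (t n m : nat) (B : 'M[int]_(m, 4 ^ n * t)) :
    'M[int]_(2 * m + 2 * (4 ^ n * t), 4 ^ n.+1 * t) :=
  castmx (B_rows m (4 ^ n * t), B_cols t n)
    (col_mx (exchange_mx 2 *t B *t ones_mx 1 2)
            ((1%:M : 'M[int]_2) *t P_mx t n *t ones_mx 1 2)).

Lemma C_rows t n : (2 ^ n.+1 * 2 * ((4 ^ n * t) %/ 2 ^ n) = 4 ^ n.+1 * t)%N.
Proof.
have -> : ((4 ^ n * t) %/ 2 ^ n = 2 ^ n * t)%N.
  by rewrite expn_4_2 -mulnA mulKn ?expn_gt0.
by rewrite mulnA -[(2 ^ n.+1 * 2 * 2 ^ n)%N]mulnA -expnS expn_4_2.
Qed.

Lemma C_cols m w : (1 * 2 * m + 1 * 2 * w = 2 * m + 2 * w)%N.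
Proof. by rewrite !mul1n. Qed.

(* C_n |-> C_(n+1), for n >= 1, where C_n has m columns. *)
Definition C_step (t n m : nat) (C : 'M[int]_(4 ^ n * t, m)) :
    'M[int]_(4 ^ n.+1 * t, 2 * m + 2 * (4 ^ n * t)) :=
  castmx (C_rows t n, C_cols m (4 ^ n * t))
    (row_mx (ones_mx (2 ^ n.+1) 1 *t (1%:M : 'M[int]_2) *t alpha (2 ^ n) C)
            (ones_mx (2 ^ n.+1) 1 *t (1%:M : 'M[int]_2)
               *t alpha (2 ^ n) (P_mx t n))).

(* (A_n, B_n, C_n) |-> A_(n+1), for n >= 1. *)
Definition A_step (t n m : nat) (A : 'M[int]_m) (B : 'M[int]_(m, 4 ^ n * t))
    (C : 'M[int]_(4 ^ n * t, m)) : 'M[int]_(2 * m + 2 * (4 ^ n * t)) :=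
  block_mx ((1%:M : 'M[int]_2) *t A) ((1%:M : 'M[int]_2) *t B)
           (exchange_mx 2 *t C)      (exchange_mx 2 *t P_mx t n).

(* The sequences below start at 0 where the matrices A_n, B_n, C_n start at
   n = 1: [A_mx ... n] is A_(n+1), and [A_order v t n] is its order. *)
Fixpoint A_order (v t n : nat) : nat :=
  if n is n'.+1 then (2 * A_order v t n' + 2 * (4 ^ n'.+1 * t))%N else v.

Fixpoint B_mx (v t : nat) (B1 : 'M[int]_(v, 4 * t)) (n : nat) :
    'M[int]_(A_order v t n, 4 ^ n.+1 * t) :=
  match n with
  | 0 => B1
  | n'.+1 => B_step (B_mx B1 n')
  end.

Fixpoint C_mx (v t : nat) (C1 : 'M[int]_(4 * t, v)) (n : nat) :
    'M[int]_(4 ^ n.+1 * t, A_order v t n) :=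
  match n with
  | 0 => C1
  | n'.+1 => C_step (C_mx C1 n')
  end.

Fixpoint A_mx (v t : nat) (A1 : 'M[int]_v) (B1 : 'M[int]_(v, 4 * t))
    (C1 : 'M[int]_(4 * t, v)) (n : nat) : 'M[int]_(A_order v t n) :=
  match n with
  | 0 => A1
  | n'.+1 => A_step (A_mx A1 B1 C1 n') (B_mx B1 n') (C_mx C1 n')
  end.

Definition row_blocky (v t : nat) (B : 'M[int]_(v, 4 * t)) : Prop :=
  forall i : 'I_v,
    (forall j : 'I_(4 * t), B i j = if (j < 2 * t)%N then 1 else 0) \/
    (forall j : 'I_(4 * t), B i j = if (j < 2 * t)%N then 0 else 1).

Definition col_blocky (v t : nat) (C : 'M[int]_(4 * t, v)) : Prop :=
  forall j : 'I_v,
    #|[set i : 'I_(4 * t) | (i < 2 * t)%N & C i j == 1]| = t /\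
    #|[set i : 'I_(4 * t) | (2 * t <= i)%N & C i j == 1]| = t.

(* Main.v *)
Require Import Defs.
From mathcomp Require Import zify ring.
Import GRing.Theory.
Local Open Scope ring_scope.

(* Write N = 2^n and cut the 4^n t indices into N blocks of N t.  Every row of
   B_n is the indicator of one block, every column of C_n sums to t over each
   block, and P_n has both properties; this alone gives
   B_n C_n = B_n P_n = P_n C_n = P_n^2 = t J.  Up to repeating rows and columns
   (a row map h and a column map g),
     B_(n+1) ~ (K_2 (x) B_n ; I_2 (x) P_n),  C_(n+1) ~ (I_2 (x) C_n , I_2 (x) P_n),
     P_(n+1) ~ K_2 (x) P_n,
   with the same h and g throughout, so the remaining relations
   A^2 + sA = AB + sB = CA + sC = CB + sP = t J all pass from n to n+1 by one
   computation with 2 x 2 blocks, based on I_2 + K_2 = J_2 and K_2^2 = I_2. *)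

(** * Indices, digits and the recursive form of [P_mx], [B_step] and [C_step] *)

Lemma expn4_block t n : (4 ^ n * t = 2 ^ n * (2 ^ n * t))%N.
Proof. by rewrite expn_4_2 mulnA. Qed.

(** An index is itself a witness that t > 0, which spares the entrywise lemmas a hypothesis. *)
Lemma ord_mul_gt0 a t (i : 'I_(a * t)) : (0 < t)%N.
Proof. by case: t i => // -[i]; rewrite muln0. Qed.

Lemma B_col_proof t n (j : 'I_(4 ^ n.+1 * t)) : (j %/ 2 < 2 * (4 ^ n * t))%N.
Proof. by rewrite ltn_divLR // B_cols. Qed.

(* The column map g of the header, [B_col], and the row map h, [C_row]. *)
Definition B_col t n (j : 'I_(4 ^ n.+1 * t)) : 'I_(2 * (4 ^ n * t)) :=
  Ordinal (B_col_proof t n j).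

Lemma C_row_proof t n (i : 'I_(4 ^ n.+1 * t)) :
  (i %% (2 ^ n * t) < 4 ^ n * t)%N.
Proof.
have t_gt0 := ord_mul_gt0 _ _ i.
rewrite (expn4_block t n) (leq_trans (ltn_pmod _ _)) ?muln_gt0 ?expn_gt0 //.
by rewrite leq_pmull ?expn_gt0.
Qed.

Definition C_row t n (i : 'I_(4 ^ n.+1 * t)) : 'I_(2 * (4 ^ n * t)) :=
  mxtens_index (Ordinal (ltn_pmod (i %/ (2 ^ n * t)) (ltn0Sn 1)),
                Ordinal (C_row_proof t n i)).

(** The all-ones factors ignore their digits. What remains is the middle digit of the row and the
    leading digit of the column, paired by the exchange matrix. *)
Lemma P_mxE t n i j :
  P_mx t n i j = (((i %/ t) %% 2 ^ n + j %/ (2 ^ n * t)).+1 == 2 ^ n)%N%:R.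
Proof.
rewrite castmxE !mxE /= mul1r mulr1 [(t * _)%N]mulnC.
have t_gt0 := ord_mul_gt0 _ _ j.
rewrite (@modn_small (j %/ _)) // ltn_divLR ?muln_gt0 ?expn_gt0 //=.
by rewrite -expn4_block.
Qed.

(** This is K_(2N) = K_2 (x) K_N: reversing a two-digit number, most significant digit 0 or 1 and
    the other in base N, reverses each digit. *)
Lemma exchange_digits N p q : (0 < N)%N -> (p < 2 * N)%N -> (q < 2 * N)%N ->
  ((p + q).+1 == 2 * N)%N =
  ((p %/ N + q %/ N).+1 == 2)%N && ((p %% N + q %% N).+1 == N)%N.
Proof.
move=> N_gt0 ltp ltq.
have := ltn_pmod p N_gt0; have := ltn_pmod q N_gt0.
have : (p %/ N < 2)%N by rewrite ltn_divLR.
have : (q %/ N < 2)%N by rewrite ltn_divLR.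
rewrite {3}(divn_eq p N) {3}(divn_eq q N).
move: (p %/ N)%N (q %/ N)%N (p %% N)%N (q %% N)%N => a b c d.
case: a => [|[|a]] //; case: b => [|[|b]] //= _ _ ltd ltc.
- by apply/negbTE/eqP; lia.
- by apply/eqP/eqP; lia.
- by apply/eqP/eqP; lia.
- by apply/negbTE/eqP; lia.
Qed.

Section BlockIndices.

Variables t n : nat.

(** Halving j undoes the factor J_(1,2). The leading binary digit of the new block number then
    selects the 2 x 2 block, and the remaining digits are the old block number. *)
Lemma B_col_high (j : nat) :
  (j %/ 2 %/ (4 ^ n * t) = j %/ (2 ^ n.+1 * t) %/ 2 ^ n)%N.
Proof. by rewrite -!divnMA; congr divn; rewrite expn4_block expnS; ring. Qed.

Lemma B_col_low (j : nat) :
  ((j %/ 2) %% (4 ^ n * t) %/ (2 ^ n * t) = (j %/ (2 ^ n.+1 * t)) %% 2 ^ n)%N.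
Proof. by rewrite expn4_block -modn_divl -divnMA expnS mulnA. Qed.

End BlockIndices.

(** The row digit of P_(n+1) lies below 2^(n+1); its leading bit and its residue mod 2^n are the two
    digits that [C_row] preserves, so [exchange_digits] applies. *)
Lemma P_step t n :
  P_mx t n.+1 = mxsub (C_row t n) (B_col t n) (exchange_mx 2 *t P_mx t n).
Proof.
apply/matrixP => i j; rewrite P_mxE !mxE mxtens_indexK P_mxE /=.
have t_gt0 := ord_mul_gt0 _ _ i.
rewrite B_col_high B_col_low.
have ltq : (j %/ (2 ^ n.+1 * t) < 2 * 2 ^ n)%N.
  by rewrite ltn_divLR ?muln_gt0 ?expn_gt0 // -expnS -expn4_block.
have ltp : ((i %/ t) %% 2 ^ n.+1 < 2 * 2 ^ n)%N.
  by rewrite -expnS ltn_mod expn_gt0.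
move: (i : nat) (j : nat) ltq ltp => {}i {}j.
rewrite !expnS => ltq ltp; rewrite -natrM mulnb exchange_digits ?expn_gt0 //.
rewrite -!modn_divl modn_mod -divnMA [(t * _)%N]mulnC.
by rewrite modn_dvdm // dvdn_mull.
Qed.

Lemma B_stepE t n m (B : 'M_(m, 4 ^ n * t)) :
  B_step B = colsub (B_col t n)
    (col_mx (exchange_mx 2 *t B) ((1%:M : 'M_2) *t P_mx t n)).
Proof.
(* Only the positions of entries matter, so P_n may be any matrix. *)
rewrite /B_step; move: (P_mx t n) => Q.
apply/matrixP => i j; rewrite castmxE [RHS]mxE; case: (split_ordP i) => i0 ->.
  have -> : cast_ord (esym (B_rows m (4 ^ n * t))) (lshift _ i0)
    = lshift _ (cast_ord (esym (muln1 _)) i0) by apply: val_inj.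
  rewrite !col_mxEu !mxE /= mulr1; congr (_ * B _ _); last exact: val_inj.
    by rewrite divn1.
  by apply: val_inj; rewrite /= divn1.
have -> : cast_ord (esym (B_rows m (4 ^ n * t))) (rshift _ i0)
  = rshift _ (cast_ord (esym (muln1 _)) i0) by apply: val_inj; rewrite /= muln1.
rewrite !col_mxEd !mxE /= mulr1; congr (_ * Q _ _); last exact: val_inj.
  by rewrite /= -!val_eqE /= divn1.
by apply: val_inj; rewrite /= divn1.
Qed.

(** Since [alpha] keeps the first 2^n t rows and J repeats them, the old row is i mod 2^n t, always
    in the first block. *)
Lemma C_stepE t n m (C : 'M_(4 ^ n * t, m)) :
  C_step C = rowsub (C_row t n)
    (row_mx ((1%:M : 'M_2) *t C) ((1%:M : 'M_2) *t P_mx t n)).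
Proof.
have dE : ((4 ^ n * t) %/ 2 ^ n = 2 ^ n * t)%N.
  by rewrite expn4_block mulKn ?expn_gt0.
rewrite /C_step; move: (P_mx t n) => Q.
apply/matrixP => i j; rewrite castmxE [RHS]mxE; case: (split_ordP j) => j0 ->.
  have -> : cast_ord (esym (C_cols m (4 ^ n * t))) (lshift _ j0)
    = lshift _ (cast_ord (esym (congr1 (muln^~ m) (mul1n 2))) j0).
    by apply: val_inj.
  rewrite !row_mxEl !mxE !mxtens_indexK /= mul1r; congr (_ * C _ _).
  - rewrite -!val_eqE /= dE [(_ %/ m %% 2)%N]modn_small //.
    by rewrite ltn_divLR ?(ord_mul_gt0 _ _ j0).
  - by apply: val_inj; rewrite /= dE.
  - exact: val_inj.
have -> : cast_ord (esym (C_cols m (4 ^ n * t))) (rshift _ j0)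
  = rshift _ (cast_ord (esym (congr1 (muln^~ (4 ^ n * t)%N) (mul1n 2))) j0).
  by apply: val_inj.
rewrite !row_mxEr !mxE !mxtens_indexK /= mul1r; congr (_ * Q _ _).
- rewrite -!val_eqE /= dE [(_ %/ (4 ^ n * t) %% 2)%N]modn_small //.
  have t_gt0 := ord_mul_gt0 _ _ i.
  by rewrite ltn_divLR ?muln_gt0 ?expn_gt0.
- by apply: val_inj; rewrite /= dE.
- exact: val_inj.
Qed.

(** * Block rows and block columns *)

(** The indices with quotient y form the interval from y d to (y+1) d, which fits below K. With [f]
    defined on [nat] the interval can be shifted freely. *)
Lemma sum_block (d y K : nat) (f : nat -> int) :
    (0 < d)%N -> (y.+1 * d <= K)%N ->
  \sum_(i < K | (i %/ d == y)%N) f i = \sum_(r < d) f (y * d + r)%N.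
Proof.
move=> d_gt0 leK.
rewrite -(big_mkord (fun i => (i %/ d == y)%N) f) big_mkcond /=.
rewrite (@big_cat_nat _ _ _ (y.+1 * d)%N) //= [X in _ + X]big1_seq ?addr0.
  rewrite (@big_cat_nat _ _ _ (y * d)%N) //= ?leq_mul2r ?leqnSn ?orbT //.
  rewrite [X in X + _]big1_seq ?add0r.
    rewrite -{1}[(y * d)%N]add0n big_addn mulSn addnK big_mkord.
    apply: eq_bigr => r _.
    by rewrite addnC divnMDl // divn_small // addn0 eqxx.
  move=> i /=; rewrite mem_index_iota /= -ltn_divLR // => lti.
  by rewrite ltn_eqF.
move=> i /=; rewrite mem_index_iota -leq_divRL // => /andP[lti _].
by rewrite gtn_eqF.
Qed.

Lemma ord_fun_natE (w : nat) (F : 'I_w -> int) :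
  exists f : nat -> int, forall i : 'I_w, F i = f i.
Proof.
exists (fun j => if insub j is Some i then F i else 0) => i.
by rewrite valK.
Qed.

(** This and [block_cols] carry the blockiness conditions through the recursion. For n = 1 the two
    blocks are the halves in (i) and (ii), the number of ones in a 0-1 column being its sum. *)
Definition block_rows t n m (B : 'M[int]_(m, 4 ^ n * t)) : Prop :=
  forall i, exists2 x, (x < 2 ^ n)%N &
    forall j, B i j = (j %/ (2 ^ n * t) == x)%N%:R.

Definition block_cols t n m (C : 'M[int]_(4 ^ n * t, m)) : Prop :=
  forall x l, (x < 2 ^ n)%N ->
    \sum_(i < 4 ^ n * t | (i %/ (2 ^ n * t) == x)%N) C i l = t%:Z.

Lemma block_le t n x : (x < 2 ^ n)%N -> (x.+1 * (2 ^ n * t) <= 4 ^ n * t)%N.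
Proof. by move=> ltx; rewrite expn4_block leq_mul2r ltx orbT. Qed.

Section BlockMatrices.

Variables t n : nat.
Hypothesis t_gt0 : (0 < t)%N.

Let N_gt0 : (0 < 2 ^ n)%N. Proof. by rewrite expn_gt0. Qed.
Let d_gt0 : (0 < 2 ^ n * t)%N. Proof. by rewrite muln_gt0 N_gt0. Qed.

(** A row of B selects one block, over which every column of C sums to t. *)
Lemma mulmx_block_rows_cols m p (B : 'M_(m, 4 ^ n * t)) (C : 'M_(_, p)) :
  block_rows t n m B -> block_cols t n p C -> B *m C = t%:Z *: ones_mx m p.
Proof.
move=> hB hC; apply/matrixP => i l; rewrite !mxE mulr1.
have [x ltx Bx] := hB i; rewrite -(hC x l ltx) [RHS]big_mkcond /=.
by apply: eq_bigr => j _; rewrite Bx; case: eqP; rewrite ?mul1r ?mul0r.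
Qed.

Lemma block_rows_sum m (B : 'M_(m, 4 ^ n * t)) : block_rows t n m B ->
  B *m ones_mx _ 1 = (2 ^ n * t)%N%:Z *: ones_mx m 1.
Proof.
move=> hB; apply/matrixP => i l; rewrite !mxE mulr1.
have [x ltx Bx] := hB i.
transitivity (\sum_(j < 4 ^ n * t | (j %/ (2 ^ n * t) == x)%N) (1 : int)).
  rewrite [RHS]big_mkcond /=; apply: eq_bigr => j _.
  by rewrite Bx mxE mulr1; case: eqP.
rewrite (sum_block _ _ _ (fun=> 1)) ?block_le //.
by rewrite sumr_const card_ord natz.
Qed.

Lemma block_cols_sum m (C : 'M_(4 ^ n * t, m)) : block_cols t n m C ->
  ones_mx 1 _ *m C = (2 ^ n * t)%N%:Z *: ones_mx 1 m.
Proof.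
move=> hC; apply/matrixP => i l; rewrite !mxE mulr1.
have ltq (j : 'I_(4 ^ n * t)) : (j %/ (2 ^ n * t) < 2 ^ n)%N.
  by rewrite ltn_divLR // -expn4_block.
(* The column is summed block by block: 2^n blocks, each contributing t. *)
rewrite (partition_big (fun j => Ordinal (ltq j)) predT) //=.
rewrite PoszM -[X in X * _]natz mulr_natl -[X in _ *+ X]card_ord -sumr_const.
apply: eq_bigr => x _; rewrite -(hC x l (ltn_ord x)).
by apply: eq_big => j; rewrite -?val_eqE //= mxE mul1r.
Qed.

Lemma P_block_rows : block_rows t n _ (P_mx t n).
Proof.
move=> i; have ltb : ((i %/ t) %% 2 ^ n < 2 ^ n)%N by rewrite ltn_mod.
(* The exchange matrix pairs the digit b with 2^n - 1 - b. *)
exists (2 ^ n - ((i %/ t) %% 2 ^ n).+1)%N; first by rewrite ltn_subrL N_gt0.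
move=> j; rewrite P_mxE.
move: ltb; move: ((i %/ t) %% _)%N (j %/ _)%N => b q ltb.
by  congr (nat_of_bool _)%:R; apply/eqP/eqP; lia.
Qed.

(** Within a block the row digit takes each value below 2^n exactly t times, and a column of P_n
    singles out one value. *)
Lemma P_block_cols : block_cols t n _ (P_mx t n).
Proof.
move=> x l ltx.
have ltq : (l %/ (2 ^ n * t) < 2 ^ n)%N.
  by rewrite ltn_divLR // -expn4_block.
under eq_bigr do rewrite P_mxE.
set b := (2 ^ n - (l %/ (2 ^ n * t)).+1)%N.
have ltb : (b < 2 ^ n)%N by rewrite ltn_subrL N_gt0.
rewrite (sum_block _ _ _ (fun i => (((i %/ t) %% 2 ^ n +
  l %/ (2 ^ n * t)).+1 == 2 ^ n)%N%:R)) ?block_le //.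
transitivity (\sum_(r < 2 ^ n * t | (r %/ t == b)%N) (1 : int)); last first.
  rewrite (sum_block _ _ _ (fun=> 1)) ?leq_mul2r ?ltb ?orbT //.
  by rewrite sumr_const card_ord natz.
rewrite [RHS]big_mkcond /=; apply: eq_bigr => r _.
have ltr : (r %/ t < 2 ^ n)%N by rewrite ltn_divLR.
rewrite mulnA divnMDl // modnMDl modn_small //.
have -> : ((r %/ t + l %/ (2 ^ n * t)).+1 == 2 ^ n)%N = (r %/ t == b)%N.
  rewrite /b; move: (r %/ t)%N (l %/ _)%N ltq ltr => q c ltq ltr.
  by apply/eqP/eqP; lia.
by case: eqP.
Qed.

Lemma B_step_block_rows m (B : 'M_(m, 4 ^ n * t)) : block_rows t n m B ->
  block_rows t n.+1 _ (B_step B).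
Proof.
move=> hB i.
(* A block number is recognised by its leading binary digit and the rest. *)
have digits (c x y : nat) : (x < 2 ^ n)%N ->
    ((y %/ 2 ^ n == c) && (y %% 2 ^ n == x) = (y == c * 2 ^ n + x))%N.
  move=> ltx; apply/andP/eqP => [[/eqP <- /eqP <-]|->].
    exact: divn_eq.
  by rewrite divnMDl // modnMDl divn_small // modn_small // addn0 !eqxx.
case: (split_ordP i) => i0 ->; case: (mxtens_indexP i0) => a {}i0.
  have [x ltx Bx] := hB i0.
  (* K_2 flips the leading digit a; below, I_2 keeps it. *)
  exists ((1 - a) * 2 ^ n + x)%N; first by rewrite expnS; lia.
  move=> j; rewrite B_stepE mxE col_mxEu mxE mxtens_indexK mxE Bx /=.
  rewrite B_col_high B_col_low -natrM mulnb -digits //.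
  congr (nat_of_bool (_ && _))%:R.
  by have := ltn_ord a; case: (nat_of_ord a) => [|[]] //= _;
    rewrite ?eqSS ?add0n ?add1n.
have [x ltx Px] := P_block_rows i0.
exists (a * 2 ^ n + x)%N;
  first by have := leq_mul (leq_ord a) (leqnn (2 ^ n)); rewrite expnS; lia.
move=> j; rewrite B_stepE mxE col_mxEd mxE mxtens_indexK mxE Px /=.
rewrite -val_eqE /= B_col_high B_col_low -natrM mulnb -digits //.
by rewrite [in RHS]eq_sym.
Qed.

(** A new block consists of two runs of 2^n t rows. The factor I_2 keeps run a, and [C_row] maps
    that run onto the first old block, whatever x is. *)
Lemma C_row_block_sum (x : nat) (a : 'I_2) (F : 'I_(4 ^ n * t) -> int) :
    (x < 2 ^ n.+1)%N ->
  \sum_(i < 4 ^ n.+1 * t | (i %/ (2 ^ n.+1 * t) == x)%N)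
    ((mxtens_unindex (C_row t n i)).1 == a)%:R
      * F (mxtens_unindex (C_row t n i)).2
  = \sum_(i < 4 ^ n * t | (i %/ (2 ^ n * t) == 0)%N) F i.
Proof.
move=> ltx; have [f Ff] := ord_fun_natE _ F.
rewrite [RHS](eq_bigr (fun i : 'I__ => f i)); last by [].
rewrite sum_block ?block_le //; under eq_bigr do rewrite mxtens_indexK Ff /=.
(* Among all runs of length 2^n t, run a of block x has number 2x + a. *)
transitivity (\sum_(i < 4 ^ n.+1 * t | (i %/ (2 ^ n * t) == 2 * x + a)%N)
    f (i %% (2 ^ n * t))%N).
  rewrite [LHS]big_mkcond [RHS]big_mkcond; apply: eq_bigr => i _.
  have dE : (2 ^ n.+1 * t = 2 ^ n * t * 2)%N by rewrite expnS; ring.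
  rewrite dE divnMA -val_eqE /=.
  have -> : (i %/ (2 ^ n * t) == 2 * x + a)%N =
     (i %/ (2 ^ n * t) %/ 2 == x)%N && ((i %/ (2 ^ n * t)) %% 2 == a)%N.
    have := ltn_ord a; move: (_ %/ (2 ^ n * t))%N => q lta.
    by apply/eqP/andP => [->|[/eqP <- /eqP <-]]; [split; apply/eqP|]; lia.
  by case: eqP => //= _; case: eqP; rewrite ?mul1r ?mul0r.
rewrite (sum_block _ _ _ (fun i => f (i %% (2 ^ n * t))%N)) //; last first.
  have := ltn_ord a; rewrite (expn4_block t n.+1) !expnS.
  move: ltx; rewrite expnS; nia.
by apply: eq_bigr => r _; rewrite modnMDl modn_small // mul0n.
Qed.

Lemma C_step_block_cols m (C : 'M_(4 ^ n * t, m)) : block_cols t n m C ->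
  block_cols t n.+1 _ (C_step C).
Proof.
move=> hC x l ltx; rewrite C_stepE.
case: (split_ordP l) => l0 ->; case: (mxtens_indexP l0) => a {}l0.
  rewrite -(hC 0%N l0 N_gt0) -(C_row_block_sum x a (C^~ l0) ltx).
  apply: eq_bigr => i _.
  by rewrite [LHS]mxE row_mxEl mxE mxtens_indexK /= mxE.
rewrite -(P_block_cols 0%N l0 N_gt0) -(C_row_block_sum x a (P_mx t n ^~ l0) ltx).
apply: eq_bigr => i _.
by rewrite [LHS]mxE row_mxEr mxE mxtens_indexK /= mxE.
Qed.

End BlockMatrices.

(** * All-ones matrices and Kronecker products with I_2 and K_2 *)

Lemma ones_row_mx m p q : ones_mx m (p + q) = row_mx (ones_mx m p) (ones_mx m q).
Proof. by rewrite /ones_mx row_mx_const. Qed.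

Lemma ones_col_mx m p q : ones_mx (m + p) q = col_mx (ones_mx m q) (ones_mx p q).
Proof. by rewrite /ones_mx col_mx_const. Qed.

Lemma ones_tens m n p q : ones_mx (m * n) (p * q) = ones_mx m p *t ones_mx n q.
Proof. by apply/matrixP => i j; rewrite !mxE mulr1. Qed.

Lemma exchange2K : exchange_mx 2 *m exchange_mx 2 = 1%:M.
Proof.
apply/matrixP => i j; rewrite !mxE !big_ord_recl big_ord0 !mxE /=.
by case: i => [[|[|?]] ?] //; case: j => [[|[|?]] ?].
Qed.

Lemma add1_exchange2 : 1%:M + exchange_mx 2 = ones_mx 2 2.
Proof.
apply/matrixP => i j; rewrite !mxE.
by case: i => [[|[|?]] ?] //; case: j => [[|[|?]] ?].
Qed.

Lemma exchange2_ones : exchange_mx 2 *m ones_mx 2 1 = ones_mx 2 1.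
Proof.
apply/matrixP => i j; rewrite !mxE !big_ord_recl big_ord0 !mxE /=.
by case: i => [[|[|?]] ?].
Qed.

Lemma ones_exchange2 : ones_mx 1 2 *m exchange_mx 2 = ones_mx 1 2.
Proof.
apply/matrixP => i j; rewrite !mxE !big_ord_recl big_ord0 !mxE /=.
by case: j => [[|[|?]] ?].
Qed.

(** The left side regroups as U (x) (X + sZ) + V (x) Y = (U + V) (x) cJ. It serves with I_2 and K_2
    as U and V, in either order. *)
Lemma tens_complement (c s : int) a b m p (U V : 'M[int]_(a, b))
    (X Y Z : 'M[int]_(m, p)) :
  U + V = ones_mx a b -> X + s *: Z = c *: ones_mx m p ->
  Y = c *: ones_mx m p ->
  U *t X + V *t Y + s *: (U *t Z) = c *: ones_mx (a * m) (b * p).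
Proof.
move=> UV XZ ->; apply/matrixP => i j; rewrite !mxE.
set i1 := (mxtens_unindex i).1; set j1 := (mxtens_unindex j).1.
set i2 := (mxtens_unindex i).2; set j2 := (mxtens_unindex j).2.
have /matrixP/(_ i1 j1) := UV; have /matrixP/(_ i2 j2) := XZ; rewrite !mxE.
by move=> /(canRL (addrK _)) -> /(canRL (addKr _)) ->; ring.
Qed.

Lemma tens_row_sum a b m p (U : 'M[int]_(a, b)) (X : 'M[int]_(m, p)) (c : int) :
  U *m ones_mx b 1 = ones_mx a 1 -> X *m ones_mx p 1 = c *: ones_mx m 1 ->
  (U *t X) *m ones_mx (b * p) 1 = c *: ones_mx (a * m) 1.
Proof.
move=> hU hX.
transitivity ((U *m ones_mx b 1) *t (X *m ones_mx p 1)).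
  by rewrite -tensmx_mul -ones_tens.
rewrite hU hX.
by apply/matrixP => i j; rewrite !mxE mul1r.
Qed.

Lemma tens_col_sum a b m p (U : 'M[int]_(a, b)) (X : 'M[int]_(m, p)) (c : int) :
  ones_mx 1 a *m U = ones_mx 1 b -> ones_mx 1 m *m X = c *: ones_mx 1 p ->
  ones_mx 1 (a * m) *m (U *t X) = c *: ones_mx 1 (b * p).
Proof.
move=> hU hX.
transitivity ((ones_mx 1 a *m U) *t (ones_mx 1 m *m X)).
  by rewrite -tensmx_mul -ones_tens.
rewrite hU hX.
by apply/matrixP => i j; rewrite !mxE mul1r.
Qed.

Lemma mxsub_addZ m p m' p' (f : 'I_m' -> 'I_m) (g : 'I_p' -> 'I_p) (s : int)
    (X Y : 'M[int]_(m, p)) :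
  mxsub f g X + s *: mxsub f g Y = mxsub f g (X + s *: Y).
Proof. by apply/matrixP => i j; rewrite !mxE. Qed.

Lemma mxsub_scale_ones m p m' p' (f : 'I_m' -> 'I_m) (g : 'I_p' -> 'I_p)
    (c : int) :
  mxsub f g (c *: ones_mx m p) = c *: ones_mx m' p'.
Proof. by apply/matrixP => i j; rewrite !mxE. Qed.

(** All columns of the product are equal, so one determines the rest. This passes between the square
    J of the statement and the vectors of the invariant. *)
Lemma row_sum_ones m p q r (X : 'M[int]_(m, p)) (c : int) : (0 < q)%N ->
  X *m ones_mx p q = c *: ones_mx m q -> X *m ones_mx p r = c *: ones_mx m r.
Proof.
move=> q_gt0 /matrixP hX; apply/matrixP => i j.
have := hX i (Ordinal q_gt0); rewrite !mxE => <-.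
by apply: eq_bigr => l _; rewrite !mxE.
Qed.

Lemma col_sum_ones m p q r (X : 'M[int]_(m, p)) (c : int) : (0 < q)%N ->
  ones_mx q m *m X = c *: ones_mx q p -> ones_mx r m *m X = c *: ones_mx r p.
Proof.
move=> q_gt0 /matrixP hX; apply/matrixP => i j.
have := hX (Ordinal q_gt0) j; rewrite !mxE => <-.
by apply: eq_bigr => l _; rewrite !mxE.
Qed.

Lemma tens_zero_one a b m p (U : 'M[int]_(a, b)) (X : 'M[int]_(m, p)) :
  zero_one_mx U -> zero_one_mx X -> zero_one_mx (U *t X).
Proof.
move=> hU hX i j; rewrite mxE.
by case: (hU (mxtens_unindex i).1 (mxtens_unindex j).1) => ->;
   rewrite ?mul0r ?mul1r; [left|apply: hX].
Qed.

Lemma bool_mx_zero_one (m l : nat) (p : 'I_m -> 'I_l -> bool)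
    (X : 'M[int]_(m, l)) :
  (forall i j, X i j = (p i j)%:R) -> zero_one_mx X.
Proof. by move=> hX i j; rewrite hX; case: (p i j); [right|left]. Qed.

Lemma block_rows_zero_one t n m (B : 'M_(m, 4 ^ n * t)) :
  block_rows t n m B -> zero_one_mx B.
Proof.
move=> hB i j; have [x _ ->] := hB i.
by case: eqP => _; [right|left].
Qed.

(** * The invariant and its passage from n to n + 1 *)

(** The induction hypothesis. [ext_B] and [ext_C] supply the products BC, BP, PC and the row sums of
    B and column sums of C; the other fields are the relations involving s, the sums equal to k, and
    what makes A an adjacency matrix. *)
Record srd_extension (t n : nat) (k s : int) (m : nat) (A : 'M[int]_m)
    (B : 'M[int]_(m, 4 ^ n * t)) (C : 'M[int]_(4 ^ n * t, m)) : Prop := {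
  ext_A01 : zero_one_mx A;
  ext_C01 : zero_one_mx C;
  ext_diag : forall i, A i i = 0;
  ext_B : block_rows t n m B;
  ext_C : block_cols t n m C;
  ext_AA : A *m A + s *: A = t%:Z *: ones_mx _ _;
  ext_AB : A *m B + s *: B = t%:Z *: ones_mx _ _;
  ext_CA : C *m A + s *: C = t%:Z *: ones_mx _ _;
  ext_CB : C *m B + s *: P_mx t n = t%:Z *: ones_mx _ _;
  ext_AJ : A *m ones_mx m 1 = k *: ones_mx m 1;
  ext_JA : ones_mx 1 m *m A = k *: ones_mx 1 m;
  ext_JB : ones_mx 1 m *m B = k *: ones_mx 1 _;
  ext_CJ : C *m ones_mx m 1 = k *: ones_mx _ 1
}.

(** The degree grows by 2^n t, the common row sum of B_n and P_n and column sum of C_n and P_n. *)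
Lemma srd_extension_step t n k s m A B C : (0 < t)%N ->
  srd_extension t n k s m A B C ->
  srd_extension t n.+1 (k + (2 ^ n * t)%N%:Z) s _
    (A_step A B C) (B_step B) (C_step C).
Proof.
move=> t_gt0 [A01 C01 Ad hB hC AA AB CA CB AJ JA JB CJ].
have hPr := P_block_rows t n t_gt0; have hPc := P_block_cols t n t_gt0.
have BC := mulmx_block_rows_cols t n _ _ _ _ hB hC.
have BP := mulmx_block_rows_cols t n _ _ _ _ hB hPc.
have PC := mulmx_block_rows_cols t n _ _ _ _ hPr hC.
have PP := mulmx_block_rows_cols t n _ _ _ _ hPr hPc.
have BJ := block_rows_sum t n t_gt0 _ _ hB.
have PJ := block_rows_sum t n t_gt0 _ _ hPr.
have JC := block_cols_sum t n t_gt0 _ _ hC.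
have JP := block_cols_sum t n t_gt0 _ _ hPc.
have B01 := block_rows_zero_one _ _ _ _ hB.
have P01 := block_rows_zero_one _ _ _ _ hPr.
have I01 : zero_one_mx (1%:M : 'M[int]_2).
  by apply: (bool_mx_zero_one _ _ (fun i j => i == j)) => i j; rewrite mxE.
have K01 : zero_one_mx (exchange_mx 2).
  by apply: (bool_mx_zero_one _ _ (fun i j => ((i + j).+1 == 2)%N)) => i j;
    rewrite mxE.
have IK := add1_exchange2.
have KI : exchange_mx 2 + 1%:M = ones_mx 2 2 by rewrite addrC.
have IJ : (1%:M : 'M[int]_2) *m ones_mx 2 1 = ones_mx 2 1 by rewrite mul1mx.
have JI : ones_mx 1 2 *m (1%:M : 'M[int]_2) = ones_mx 1 2 by rewrite mulmx1.
have [KJ JK] := (exchange2_ones, ones_exchange2).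
have tensE := (tensmx_mul, mul1mx, mulmx1, exchange2K).
have blockE := tens_complement t%:Z s.
split.
- move=> i j; case: (split_ordP i) => i0 ->; case: (split_ordP j) => j0 ->;
    rewrite ?block_mxEul ?block_mxEur ?block_mxEdl ?block_mxEdr;
    exact: tens_zero_one.
- rewrite C_stepE => i j; rewrite mxE; case: (split_ordP j) => j0 ->;
    rewrite ?row_mxEl ?row_mxEr; exact: tens_zero_one.
- move=> i; case: (split_ordP i) => i0 ->;
    rewrite ?block_mxEul ?block_mxEdr mxE ?Ad ?mulr0 // mxE.
  (* K_2 has zero diagonal, so K_2 (x) P_n creates no loops. *)
  by case: (mxtens_unindex i0).1 => [[|[|?]] ?] //; rewrite mul0r.
- exact: B_step_block_rows.
- exact: C_step_block_cols.
(* In each block one product comes with its s-term and the other is one of BC, BP, PC, PP, equal to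
   tJ. Their left factors are I_2 and K_2 in some order, so [tens_complement] closes all four. *)
- rewrite mulmx_block scale_block_mx add_block_mx !tensE !blockE //.
  by rewrite ones_col_mx !ones_row_mx scale_col_mx !scale_row_mx.
- rewrite B_stepE mulmx_colsub mul_block_col !tensE mxsub_addZ.
  rewrite scale_col_mx add_col_mx !blockE // -scale_col_mx -ones_col_mx.
  exact: mxsub_scale_ones.
- rewrite C_stepE mul_rowsub_mx mul_row_block !tensE mxsub_addZ.
  rewrite scale_row_mx add_row_mx !blockE // -scale_row_mx -ones_row_mx.
  exact: mxsub_scale_ones.
(* By [P_step] the term s P_(n+1) is cut out by the same row and column maps as the product. *)
- rewrite B_stepE C_stepE -mxsub_mul mul_row_col !tensE P_step mxsub_addZ.
  by rewrite blockE // mxsub_scale_ones.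
- rewrite ones_col_mx mul_block_col.
  rewrite (tens_row_sum _ _ _ _ _ _ _ IJ AJ) (tens_row_sum _ _ _ _ _ _ _ IJ BJ).
  rewrite (tens_row_sum _ _ _ _ _ _ _ KJ CJ) (tens_row_sum _ _ _ _ _ _ _ KJ PJ).
  by rewrite -!scalerDl scale_col_mx.
- rewrite ones_row_mx mul_row_block.
  rewrite (tens_col_sum _ _ _ _ _ _ _ JI JA) (tens_col_sum _ _ _ _ _ _ _ JK JC).
  rewrite (tens_col_sum _ _ _ _ _ _ _ JI JB) (tens_col_sum _ _ _ _ _ _ _ JK JP).
  by rewrite -!scalerDl scale_row_mx.
- rewrite B_stepE mulmx_colsub ones_row_mx mul_row_col.
  rewrite (tens_col_sum _ _ _ _ _ _ _ JK JB) (tens_col_sum _ _ _ _ _ _ _ JI JP).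
  by rewrite -scalerDl mxsub_scale_ones.
- rewrite C_stepE mul_rowsub_mx ones_col_mx mul_row_col.
  rewrite (tens_row_sum _ _ _ _ _ _ _ IJ CJ) (tens_row_sum _ _ _ _ _ _ _ IJ PJ).
  by rewrite -scalerDl mxsub_scale_ones.
Qed.

(** With mu = t the identity matrix cancels, and the defining equation becomes A^2 + sA = tJ. *)
Lemma srd_of_extension t n k lambda s m A B C : s = t%:Z - lambda ->
  srd_extension t n k s m A B C -> adjmx_of_srd A m k t%:Z lambda t%:Z.
Proof.
move=> sE [A01 _ Ad _ _ AA _ _ _ AJ JA _ _].
have AE : A = adjmx (fun i j => A i j == 1).
  by apply/matrixP => i j; rewrite mxE; case: (A01 i j) => ->.
exists (fun i j => A i j == 1) => //; split; rewrite -?AE //.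
- by move=> i; rewrite Ad.
- rewrite -[LHS](addrK (s *: A)) AA sE; apply/matrixP => i j; rewrite !mxE.
  by ring.
- exact: row_sum_ones AJ.
- exact: col_sum_ones JA.
Qed.

(** * The order of A_n, the base case and the induction *)

Lemma A_orderE v t n :
  A_order v t n = ((v + (2 ^ n.+2 - 4) * t) * 2 ^ n)%N.
Proof.
elim: n => [|n IHn]; first by rewrite /= subnn mul0n addn0 muln1.
rewrite [LHS]/= IHn expn_4_2 !expnS.
have : (0 < 2 ^ n)%N by rewrite expn_gt0.
(* Writing 2^n as N + 1 turns the truncated subtractions into exact ones. *)
case: (2 ^ n)%N => // N _.
have -> : (2 * (2 * N.+1) - 4 = 4 * N)%N by lia.
have -> : (2 * (2 * (2 * N.+1)) - 4 = 8 * N + 4)%N by lia.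
by ring.
Qed.

Lemma sum_zero_one m p (C : 'M[int]_(m, p)) (Q : pred 'I_m) l : zero_one_mx C ->
  \sum_(i | Q i) C i l = #|[set i | Q i & C i l == 1]|%:Z.
Proof.
move=> C01; transitivity (\sum_(i | Q i && (C i l == 1)) (1 : int)).
  by rewrite big_mkcondr; apply: eq_bigr => i _; case: (C01 i l) => ->.
by rewrite sumr_const natz cardsE.
Qed.

Lemma srd_extension_base v t k lambda s A1 B1 C1 : (0 < t)%N ->
  s = t%:Z - lambda -> adjmx_of_srd A1 v k t%:Z lambda t%:Z ->
  zero_one_mx C1 ->
  A1 *m B1 + s *: B1 = t%:Z *: ones_mx v (4 * t) ->
  C1 *m A1 + s *: C1 = t%:Z *: ones_mx (4 * t) v ->
  C1 *m B1 + s *: P_mx t 1 = t%:Z *: ones_mx (4 * t) (4 * t) ->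
  ones_mx v v *m B1 = k *: ones_mx v (4 * t) ->
  C1 *m ones_mx v v = k *: ones_mx (4 * t) v ->
  row_blocky B1 -> col_blocky C1 ->
  srd_extension t 1 k s v A1 B1 C1.
Proof.
move=> t_gt0 sE [e Ae []]; rewrite -Ae => e_irr _ AA AJ JA C01.
move=> AB CA CB JB CJ hB hC.
have d_gt0 : (0 < 2 ^ 1 * t)%N by rewrite muln_gt0.
(* If v = 0 then CB = 0, so sP = tJ, but P has zero entries. *)
have v_gt0 : (0 < v)%N.
  case: posnP => // v0; move: CB => /matrixP.
  have lt0 : (0 < 4 ^ 1 * t)%N by rewrite muln_gt0.
  move/(_ (Ordinal lt0) (Ordinal lt0)); rewrite mxE [X in _ + X]mxE P_mxE /=.
  rewrite !div0n mod0n mulr0 addr0 !mxE big1 => [|i]; last first.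
    by have lti := ltn_ord i; exfalso; lia.
  by move=> /eqP; rewrite mulr1 eq_sym; case: (t) t_gt0.
have q0 (j : 'I_(4 * t)) : (j %/ (2 ^ 1 * t) == 0)%N = (j < 2 * t)%N.
  by rewrite -leqn0 -ltnS ltn_divLR // mul1n.
have q1 (j : 'I_(4 * t)) : (j %/ (2 ^ 1 * t) == 1)%N = (2 * t <= j)%N.
  rewrite eqn_leq -ltnS ltn_divLR // leq_divRL // mul1n mulnA.
  by rewrite (ltn_ord j).
split => //.
- by move=> i j; rewrite Ae mxE; case: (e i j); [right|left].
- by move=> i; rewrite Ae mxE e_irr.
- move=> i; case: (hB i) => Bi.
    by exists 0%N => // j; rewrite Bi q0; case: ltnP.
  by exists 1%N => // j; rewrite Bi q1; case: ltnP.
- move=> [|[|x]] l //= _; have [C0 C1'] := hC l.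
    by rewrite sum_zero_one // -[in RHS]C0; congr (Posz #|pred_of_set _|);
      apply/setP => i; rewrite !inE q0.
  by rewrite sum_zero_one // -[in RHS]C1'; congr (Posz #|pred_of_set _|);
    apply/setP => i; rewrite !inE q1.
- rewrite AA sE; apply/matrixP => i j; rewrite !mxE; ring.
- exact: row_sum_ones v_gt0 AJ.
- exact: col_sum_ones v_gt0 JA.
- exact: col_sum_ones v_gt0 JB.
- exact: row_sum_ones v_gt0 CJ.
Qed.

Theorem theorem1 (v t : nat) (k lambda s : int) (ht : (1 <= t)%N)
  (hs : s = t%:Z - lambda)
  (A1 : 'M[int]_v) (B1 : 'M[int]_(v, 4 * t)) (C1 : 'M[int]_(4 * t, v))
  (hA1 : adjmx_of_srd A1 v k t%:Z lambda t%:Z)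
  (hB01 : zero_one_mx B1) (hC01 : zero_one_mx C1)
  (hBC : B1 *m C1 = t%:Z *: ones_mx v v)
  (hBP : B1 *m P_mx t 1 = t%:Z *: ones_mx v (4 * t))
  (hPC : P_mx t 1 *m C1 = t%:Z *: ones_mx (4 * t) v)
  (hAB : A1 *m B1 + s *: B1 = t%:Z *: ones_mx v (4 * t))
  (hCA : C1 *m A1 + s *: C1 = t%:Z *: ones_mx (4 * t) v)
  (hCB : C1 *m B1 + s *: P_mx t 1 = t%:Z *: ones_mx (4 * t) (4 * t))
  (hBJ : B1 *m ones_mx (4 * t) (4 * t) = (2 * t)%:Z *: ones_mx v (4 * t))
  (hJB : ones_mx v v *m B1 = k *: ones_mx v (4 * t))
  (hCJ : C1 *m ones_mx v v = k *: ones_mx (4 * t) v)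
  (hJC : ones_mx (4 * t) (4 * t) *m C1 = (2 * t)%:Z *: ones_mx (4 * t) v)
  (hBblock : row_blocky B1) (hCblock : col_blocky C1)
  (n : nat) (hn : (1 <= n)%N) :
  adjmx_of_srd (A_mx A1 B1 C1 n.-1)
    ((v + (2 ^ n.+1 - 4) * t) * 2 ^ n.-1)
    (k + ((2 ^ n)%:Z - 2) * t%:Z) t%:Z lambda t%:Z.
Proof.
case: n hn => // n _; rewrite [n.+1.-1]/= -A_orderE.
(* After the shift of indices, position n of the sequences holds A_(n+1), hence the invariant at
   [n.+1]. *)
suff : srd_extension t n.+1 (k + ((2 ^ n.+1)%:Z - 2) * t%:Z) s _
    (A_mx A1 B1 C1 n) (B_mx B1 n) (C_mx C1 n) by exact: srd_of_extension hs.
elim: n => [|n IHn].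
  rewrite expn1 subrr mul0r addr0.
  exact: srd_extension_base ht hs hA1 hC01 hAB hCA hCB hJB hCJ hBblock hCblock.
have -> : k + ((2 ^ n.+2)%:Z - 2) * t%:Z =
    k + ((2 ^ n.+1)%:Z - 2) * t%:Z + (2 ^ n.+1 * t)%N%:Z.
  by rewrite expnS !PoszM; ring.
exact: srd_extension_step.
Qed.
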